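(* If $n$ is odd, then the transitive tournament $T_n$ on $n$ vertices can be decomposed into $\frac{n-1}{2}$ isomorphically oriented Hamiltonian cycles; that is, the arc set of $T_n$ can be partitioned into $\frac{n-1}{2}$ digraphs that are pairwise isomorphic as digraphs and each of which is an orientation of a Hamiltonian cycle of $K_n$.
   Context: $T_n$ denotes the transitive tournament on $n$ vertices and $K_n$ its underlying complete graph. The Hamiltonian cycles are cycles of the underlying undirected graph; their orientations inherited from $T_n$ are (necessarily) not directed cycles. *)

(* Defs.v *)
From mathcomp Require Import all_boot all_fingroup.
Set Implicit Arguments.
Unset Strict Implicit.
Unset Printing Implicit Defensive.

(* On a finite vertex type V, a simple graph is given by its edge set, of type
   {set {set V}}, and a digraph by its arc set, of type {set V * V}; in both
   cases the vertex set is the whole of V. *)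

Definition complete_graph (V : finType) : {set {set V}} :=
  [set e : {set V} | #|e| == 2].

Definition transitive_tournament (n : nat) : {set 'I_n * 'I_n} :=
  [set a : 'I_n * 'I_n | a.1 < a.2].

(* Edges of the closed walk s_0, s_1, ..., s_(k-1), s_0. *)
Definition cycle_edges (V : finType) (s : seq V) : {set {set V}} :=
  [set [set x; next s x] | x in s].

Definition hamiltonian_cycle (V : finType) (G E : {set {set V}}) : Prop :=
  exists s : seq V,
    [/\ 2 < size s, uniq s, s =i V, E = cycle_edges s & E \subset G].

(* The second condition says that each edge receives only one of its two
   directions; it also excludes loops. *)
Definition orientation (V : finType) (E : {set {set V}})
    (D : {set V * V}) : Prop :=
  [set [set a.1; a.2] | a in D] = E /\
  (forall x y : V, (x, y) \in D -> (y, x) \notin D).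

Definition digraph_iso (V : finType) (C D : {set V * V}) : Prop :=
  exists f : {perm V}, forall x y : V, ((f x, f y) \in D) = ((x, y) \in C).

(* Main.v *)
Require Import Defs.
From mathcomp Require Import all_boot all_fingroup.
From mathcomp Require Import zify.
Set Implicit Arguments.
Unset Strict Implicit.
Unset Printing Implicit Defensive.

(** Write n = 2m + 1 and split the vertices into 0, ..., 2m - 1, read modulo 2m,
    and the top vertex 2m.  Walecki's decomposition of the complete graph
    consists of the m Hamiltonian cycles
      i, i + 1, i - 1, i + 2, i - 2, ..., i + m, 2m   (back to i),   0 <= i < m,
    which we orient by the order of the vertices, as in the tournament.

    They are edge-disjoint and cover everything: an edge {x, y} avoiding the top
    vertex is in the i-th cycle exactly when x + y is 2i or 2i + 1 modulo 2m, and
    the edge {x, 2m} is in it exactly when x = i modulo m.  This defines the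
    colour of an arc ([arc_colour]), which is the index of the only cycle through
    it ([arc_colour_zigzag], [mem_order_cycle_zigzag]).

    They are isomorphic as digraphs: the arcs go alternately up and down along
    the zigzag, except that i - k wraps around to i - k + 2m as soon as k > i
    (for i = m - 1, the zigzag goes on to the top vertex instead), which makes
    two consecutive arcs point up, one from vertex 0 to vertex 2i + 1 and the
    next one out of 2i + 1.  Hence, read from vertex 0, which has position 2i, each cycle has
    the pattern up, up, down, up, down, ..., up, down, independent of i
    ([shift_zigzag_ltS]).  Two cyclic arrangements with the same pattern of ups
    and downs carry isomorphic digraphs ([digraph_iso_order_cycle]). *)

(** * Digraphs carried by a cyclic arrangement *)

(** The cycle s 0, s 1, ..., s (n - 1), s 0 with every edge oriented from its
    smaller to its larger end.  As s is a permutation, the position of a vertex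
    x on the cycle is s^-1 x, and [ordS] is the cyclic successor of positions. *)
Definition order_cycle (n : nat) (s : {perm 'I_n}) : {set 'I_n * 'I_n} :=
  [set a : 'I_n * 'I_n | (a.1 < a.2) &&
    ((s^-1%g a.2 == ordS (s^-1%g a.1)) || (s^-1%g a.1 == ordS (s^-1%g a.2)))].

Lemma mem_order_cycle n (s : {perm 'I_n}) (t u : 'I_n) :
  ((s t, s u) \in order_cycle s) =
  (s t < s u) && ((u == ordS t) || (t == ordS u)).
Proof. by rewrite inE /= !permK. Qed.

Lemma order_cycle_next n (s : {perm 'I_n}) (x y t : 'I_n) :
    x < y -> (s t = x /\ s (ordS t) = y) \/ (s t = y /\ s (ordS t) = x) ->
  (x, y) \in order_cycle s.
Proof.
move=> ltxy [[sx sy]|[sy sx]]; move: ltxy; rewrite -sx -sy => lts;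
by rewrite mem_order_cycle lts eqxx ?orbT.
Qed.

Lemma order_cycleP n (s : {perm 'I_n}) (a : 'I_n * 'I_n) :
    a \in order_cycle s ->
  a.1 < a.2 /\ exists t,
    (s t = a.1 /\ s (ordS t) = a.2) \/ (s t = a.2 /\ s (ordS t) = a.1).
Proof.
rewrite inE => /andP[lta /orP[/eqP e|/eqP e]]; split=> //.
  by exists (s^-1%g a.1); left; rewrite -e !permKV.
by exists (s^-1%g a.2); right; rewrite -e !permKV.
Qed.

(** Any permutation of the positions that commutes with the cyclic successor is a
    rotation, and rotating an arrangement does not change its cycle. *)
Lemma order_cycle_rot n (r s : {perm 'I_n}) :
  (forall t, r (ordS t) = ordS (r t)) -> order_cycle (r * s)%g = order_cycle s.
Proof.
move=> rS; apply/setP=> -[x y].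
rewrite -[x](permKV (r * s)%g) -[y](permKV (r * s)%g).
move: ((r * s)^-1%g x) ((r * s)^-1%g y) => t u.
rewrite mem_order_cycle !permM mem_order_cycle -!rS.
by rewrite !(inj_eq (@perm_inj _ r)).
Qed.

Lemma digraph_iso_order_cycle n (r s : {perm 'I_n}) :
    (forall t, (r t < r (ordS t)) = (s t < s (ordS t))) ->
  digraph_iso (order_cycle r) (order_cycle s).
Proof.
(* The isomorphism sends the vertex at each position of r to the one at the
   same position of s. *)
move=> rs; exists (r^-1 * s)%g => x y.
have lt_flip (p : {perm 'I_n}) t u : t != u -> (p t < p u) = ~~ (p u < p t).
  rewrite -(inj_eq (@perm_inj _ p)) -(inj_eq val_inj) /=; lia.
rewrite -[x](permKV r) -[y](permKV r) !permM !permK.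
set t := r^-1%g x; set u := r^-1%g y; rewrite !mem_order_cycle.
have [-> | neq_tu] := eqVneq t u; first by rewrite !ltnn.
have [-> | _] /= := eqVneq u (ordS t); first by rewrite rs.
have [e | _] := eqVneq t (ordS u); last by rewrite !andbF.
by rewrite !(lt_flip _ t u) // e rs.
Qed.

Lemma next_enum_ord n (t : 'I_n) : next (enum 'I_n) t = ordS t.
Proof.
case: n t => [[]//|n] t.
apply: val_inj; rewrite next_nth mem_enum.
have -> : enum 'I_n.+1 = ord0 :: behead (enum 'I_n.+1) by rewrite enum_ordSl.
set s := behead _.
have es : ord0 :: s = enum 'I_n.+1 by rewrite /s enum_ordSl.
have -> k : nth ord0 s k = nth ord0 (ord0 :: s) k.+1 by [].
rewrite es index_enum_ord /=.
have := ltn_ord t; rewrite ltnS leq_eqVlt => /orP[/eqP et|ltt].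
  by rewrite nth_default ?size_enum_ord ?et // modnn.
by rewrite nth_enum_ord ?ltnS // modn_small.
Qed.

Lemma next_ord_arrangement n (s : {perm 'I_n}) (t : 'I_n) :
  next [seq s u | u <- enum 'I_n] (s t) = s (ordS t).
Proof. by rewrite next_map ?enum_uniq ?next_enum_ord //; apply: perm_inj. Qed.

Lemma order_cycle_hamiltonian n (s : {perm 'I_n}) : 2 < n ->
  exists E : {set {set 'I_n}},
    hamiltonian_cycle (complete_graph 'I_n) E /\ orientation E (order_cycle s).
Proof.
move=> n_gt2; set c := [seq s u | u <- enum 'I_n].
have ltS t : (s t < s (ordS t)) || (s (ordS t) < s t).
  have: s t != s (ordS t).
    rewrite (inj_eq (@perm_inj _ s)) -(inj_eq val_inj) /=.
    have := ltn_ord t; rewrite leq_eqVlt => /orP[/eqP et|ltt].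
      by rewrite et modnn; lia.
    by rewrite modn_small; lia.
  rewrite -(inj_eq val_inj) /=; lia.
have mem_c : c =i 'I_n.
  move=> x; rewrite inE; apply/mapP; exists (s^-1%g x); rewrite ?permKV //.
  by rewrite mem_enum.
exists (cycle_edges c); split.
  exists c; split=> //.
  - by rewrite size_map size_enum_ord.
  - by rewrite map_inj_uniq ?enum_uniq //; apply: perm_inj.
  apply/subsetP=> _ /imsetP[x _ ->]; rewrite inE cards2.
  rewrite -[x](permKV s) next_ord_arrangement.
  case: (eqVneq (s _)) => // e.
  by have := ltS (s^-1%g x); rewrite e ltnn.
split=> [|x y]; last by rewrite !inE /= => /andP[ltxy _]; rewrite ltnNge ltnW.
apply/setP=> e; apply/imsetP/imsetP => [[a /order_cycleP[_ [t st]] ->]|[x _ ->]].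
  exists (s t); rewrite ?mem_c // next_ord_arrangement.
  by case: st => -[-> ->] //; rewrite setUC.
rewrite -[x](permKV s) next_ord_arrangement; set t := s^-1%g x.
have /orP[lt|lt] := ltS t.
  by exists (s t, s (ordS t)) => //; apply: (order_cycle_next (t := t)) => //; left.
exists (s (ordS t), s t); last by rewrite setUC.
by apply: (order_cycle_next (t := t)) => //; right.
Qed.

(** * The zigzag arrangements *)

(* [lia] does not split conditionals by itself. *)
Ltac lia_if := repeat (case: ifP => ?); lia.

(** The vertex at position u < 2m + 1 of the i-th Walecki cycle, without modular
    arithmetic: i - k at position 2k and i + k + 1 at position 2k + 1, for k < m,
    with i - k replaced by i - k + 2m when negative, and finally the top vertex
    2m.  No reduction is needed for i + k + 1, as i < m. *)
Definition zigzag (m i u : nat) : nat :=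
  if u == m.*2 then m.*2
  else if odd u then i + u./2 + 1
  else if u./2 <= i then i - u./2 else i + m.*2 - u./2.

Lemma zigzag_lt m i u : i < m -> u < m.*2.+1 -> zigzag m i u < m.*2.+1.
Proof. rewrite /zigzag; lia_if. Qed.

Lemma zigzag_inj m i u v : i < m -> u < m.*2.+1 -> v < m.*2.+1 ->
  zigzag m i u = zigzag m i v -> u = v.
Proof. rewrite /zigzag; lia_if. Qed.

(** The arcs alternate, and the alternation is reversed after position 2i, where
    the zigzag is at vertex 0. *)
Lemma zigzag_ltS m i u : i < m -> u < m.*2 ->
  (zigzag m i u < zigzag m i u.+1) = (if u <= i.*2 then ~~ odd u else odd u).
Proof. rewrite /zigzag; lia_if. Qed.

(** The index of the Walecki cycle that contains the edge {x, y}, for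
    x < y <= 2m. *)
Definition arc_colour (m x y : nat) : nat :=
  if y == m.*2 then (if x < m then x else x - m)
  else if x + y < m.*2 then (x + y)./2 else (x + y - m.*2)./2.

Lemma arc_colour_lt m x y : x < y -> y < m.*2.+1 -> arc_colour m x y < m.
Proof. rewrite /arc_colour; lia_if. Qed.

(** The edge {x, y} occurs in the cycle of its colour.  If it avoids the top
    vertex, its ends modulo 2m are i - k and i + k, at positions 2k and 2k - 1,
    when x + y is even, and i - k and i + k + 1, at positions 2k and 2k + 1, when
    x + y is odd. *)
Lemma zigzag_edge m i x y :
    i < m -> x < y -> y < m.*2.+1 -> arc_colour m x y = i ->
  exists2 u, u < m.*2.+1 &
    let v := if u == m.*2 then 0 else u.+1 in
    (zigzag m i u = x /\ zigzag m i v = y) \/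
    (zigzag m i u = y /\ zigzag m i v = x).
Proof.
move=> lti ltxy lty; rewrite /arc_colour.
have [-> | ney] := eqVneq y m.*2.
  have [ltx e | lex e] := ltnP x m.
    by exists m.*2 => //=; rewrite eqxx; right; rewrite /zigzag; lia_if.
  exists m.*2.-1 => /=; first by lia.
  by rewrite ifN; [left; rewrite /zigzag; lia_if | lia].
case: ltnP => lexy e.
  (* No wrap-around: x = i - k, so that y - x is 2k or 2k + 1. *)
  exists (y - x).-1 => /=; first by lia.
  rewrite ifN; last by lia.
  case oxy: (odd (x + y)); [left | right]; rewrite /zigzag; lia_if.
(* Here y = i - k + 2m, so that 2m - (y - x) is 2k or 2k + 1. *)
exists (m.*2 - (y - x)).-1 => /=; first by lia.
rewrite ifN; last by lia.
case oxy: (odd (x + y)); [right | left]; rewrite /zigzag; lia_if.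
Qed.

Lemma val_ordS_odd m (t : 'I_m.*2.+1) :
  ordS t = (if t == m.*2 :> nat then 0 else t.+1) :> nat.
Proof.
rewrite /=; case: eqP => [->|net]; first by rewrite modnn.
by rewrite modn_small // ltnS ltn_neqAle -ltnS ltn_ord andbT; apply/eqP.
Qed.

Section Zigzag.

Variables (m : nat) (i : 'I_m).

Definition zigzag_ord (u : 'I_m.*2.+1) : 'I_m.*2.+1 :=
  Ordinal (zigzag_lt (ltn_ord i) (ltn_ord u)).

Lemma zigzag_ord_inj : injective zigzag_ord.
Proof.
move=> u v [/(zigzag_inj (ltn_ord i) (ltn_ord u) (ltn_ord v))].
exact: val_inj.
Qed.

Definition zigzag_perm : {perm 'I_m.*2.+1} := perm zigzag_ord_inj.

Lemma zigzag_permE u : zigzag_perm u = zigzag m i u :> nat.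
Proof. by rewrite permE. Qed.

Lemma arc_colour_zigzag a :
  a \in order_cycle zigzag_perm -> arc_colour m a.1 a.2 = i.
Proof.
case/order_cycleP=> lta [t st]; have lti := ltn_ord i; have ltt := ltn_ord t.
move: lta; case: st => -[<- <-]; rewrite !zigzag_permE val_ordS_odd;
by case: eqP => ?; rewrite /arc_colour /zigzag; lia_if.
Qed.

Lemma mem_order_cycle_zigzag (x y : 'I_m.*2.+1) :
  x < y -> arc_colour m x y = i -> (x, y) \in order_cycle zigzag_perm.
Proof.
move=> ltxy col.
have [u ltu e] := zigzag_edge (ltn_ord i) ltxy (ltn_ord y) col.
apply: (order_cycle_next (t := Ordinal ltu)) => //.
by case: e => -[ex ey]; [left | right];
   split; apply: val_inj; rewrite /= zigzag_permE ?val_ordS_odd.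
Qed.

Lemma order_cycle_zigzag_neq0 : order_cycle zigzag_perm != set0.
Proof.
have lti := ltn_ord i.
have ltx : i < m.*2.+1 by lia.
have lty : i.+1 < m.*2.+1 by lia.
apply/set0Pn; exists (Ordinal ltx, Ordinal lty).
by apply: mem_order_cycle_zigzag => //=; rewrite /arc_colour; lia_if.
Qed.

(** Rotation of the positions by 2i, which moves the start of the i-th cycle to
    vertex 0. *)
Definition shift_ord (t : 'I_m.*2.+1) : 'I_m.*2.+1 :=
  Ordinal (ltn_pmod (t + i.*2) (ltn0Sn m.*2)).

Lemma val_shift_ord t : shift_ord t =
  (if t + i.*2 <= m.*2 then t + i.*2 else t + i.*2 - m.*2.+1) :> nat.
Proof.
have ltt := ltn_ord t; have lti := ltn_ord i.
case: leqP => [le|lt] /=; first by rewrite modn_small.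
by rewrite -{1}(subnK lt) modnDr modn_small //; lia.
Qed.

Lemma shift_ord_inj : injective shift_ord.
Proof.
move=> t u /(congr1 (@nat_of_ord _)) e; apply: val_inj; move: e.
have ltt := ltn_ord t; have ltu := ltn_ord u; have lti := ltn_ord i.
by rewrite !val_shift_ord /=; lia_if.
Qed.

Definition shift_perm : {perm 'I_m.*2.+1} := perm shift_ord_inj.

Lemma shift_perm_ordS t : shift_perm (ordS t) = ordS (shift_perm t).
Proof.
rewrite !permE; apply: val_inj; rewrite [LHS]val_shift_ord [RHS]val_ordS_odd.
rewrite val_ordS_odd; have ltt := ltn_ord t; have lti := ltn_ord i.
by have := val_shift_ord t; case: (t =P m.*2 :> nat) => ?; lia_if.
Qed.

(** Read from vertex 0, the i-th cycle goes up, up, down, up, down, and so on. *)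
Lemma shift_zigzag_ltS t :
  ((shift_perm * zigzag_perm)%g t < (shift_perm * zigzag_perm)%g (ordS t)) =
  (t == 0 :> nat) || odd t.
Proof.
have ltt := ltn_ord t; have lti := ltn_ord i.
rewrite !permM shift_perm_ordS !zigzag_permE val_ordS_odd [shift_perm t]permE.
have := val_shift_ord t; have := ltn_ord (shift_ord t).
move: (shift_ord t) => u ltu; case: eqP => [-> | neu].
  by rewrite /zigzag; lia_if.
by rewrite (zigzag_ltS lti); [lia_if | lia].
Qed.

End Zigzag.

(** * The decomposition *)

Lemma digraph_iso_zigzag m (i j : 'I_m) :
  digraph_iso (order_cycle (zigzag_perm i)) (order_cycle (zigzag_perm j)).
Proof.
rewrite -(order_cycle_rot (zigzag_perm i) (@shift_perm_ordS _ i)).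
rewrite -(order_cycle_rot (zigzag_perm j) (@shift_perm_ordS _ j)).
by apply: digraph_iso_order_cycle => t; rewrite !shift_zigzag_ltS.
Qed.

Theorem corollary2 (n : nat) (n_odd : odd n) :
  exists P : {set {set 'I_n * 'I_n}},
    [/\ partition P (transitive_tournament n),
        #|P| = (n - 1) %/ 2,
        forall C D, C \in P -> D \in P -> digraph_iso C D
      & forall C, C \in P ->
          exists E : {set {set 'I_n}},
            hamiltonian_cycle (complete_graph 'I_n) E /\ orientation E C].
Proof.
have [m ->] : exists m, n = m.*2.+1 by exists n./2; lia.
pose F (i : 'I_m) := order_cycle (zigzag_perm i).
have trivF : {in 'I_m &, forall i j, j != i -> [disjoint F i & F j]}.
  move=> i j _ _; apply: contraR => /pred0Pn[a /andP[/= ai aj]].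
  by rewrite -(inj_eq val_inj) /= -(arc_colour_zigzag ai) (arc_colour_zigzag aj).
have F0 : set0 \notin F @: 'I_m.
  apply/imsetP=> -[i _ e].
  by have := order_cycle_zigzag_neq0 i; rewrite -/(F i) -e eqxx.
have [trivP Finj] := trivIimset trivF F0.
exists (F @: 'I_m); split.
- apply/and3P; split=> //; apply/eqP/setP=> -[x y]; rewrite inE /=.
  apply/bigcupP/idP=> [[_ /imsetP[i _ ->] /order_cycleP[]]//|ltxy].
  pose i := Ordinal (arc_colour_lt ltxy (ltn_ord y)).
  by exists (F i); [apply: imset_f | apply: mem_order_cycle_zigzag].
- by rewrite card_in_imset // card_ord; lia.
- by move=> _ _ /imsetP[i _ ->] /imsetP[j _ ->]; apply: digraph_iso_zigzag.
move=> _ /imsetP[i _ ->]; apply: order_cycle_hamiltonian.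
by have := ltn_ord i; lia.
Qed.
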